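(* For any lattice (respectively, bounded lattice) $L$, the map $a\mapsto\widehat{a}$ is (i) a lattice (respectively, bounded lattice) embedding of $L$ into $\mathfrak{L}(\mathsf{FI}(L))$ and (ii) an isomorphism from $L$ to the sublattice of $\mathfrak{L}(\mathsf{FI}(L))$ consisting of those $c_\vartriangleleft$-fixpoints that are compact open in the space $\mathsf{S}(L)$.
   Context: A compatibility frame is a pair $(X,\vartriangleleft)$ with $X$ a nonempty set and $\vartriangleleft$ a reflexive binary relation on $X$. Write $y\vartriangleright x$ for $x\vartriangleleft y$, and for $A\subseteq X$ let $c_\vartriangleleft(A)=\{x\in X\mid \forall x'\vartriangleleft x\ \exists x''\vartriangleright x':\ x''\in A\}$. This is a closure operator on $\wp(X)$. A $c_\vartriangleleft$-fixpoint is an $A\subseteq X$ with $c_\vartriangleleft(A)=A$. $\mathfrak{L}(X,\vartriangleleft)$ is the complete lattice of $c_\vartriangleleft$-fixpoints ordered by $\subseteq$ (meets are intersections; $\bigvee A_i=c_\vartriangleleft(\bigcup A_i)$). Given a lattice $L$, $\mathsf{FI}(L)=(X,\vartriangleleft)$, where $X$ is the set of all pairs $(F,I)$ with $F$ a filter in $L$, $I$ an ideal in $L$, and $F\cap I=\varnothing$; and $(F,I)\vartriangleleft(F',I')$ iff $I\cap F'=\varnothing$. For $a\in L$, $\widehat{a}=\{(F,I)\in X\mid a\in F\}$. $\mathsf{S}(L)$ is $\mathsf{FI}(L)$ endowed with the topology on $X$ generated by $\{\widehat{a}\mid a\in L\}$.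
   Formalization: Part (ii) fails for lattices without a least element, since the empty set is a compact open fixpoint but no â is empty; for such lattices it is stated for the nonempty compact open fixpoints only. *)

(* Defs.v *)
From HB Require Import structures.
From mathcomp Require Import all_boot all_order.
From mathcomp Require Import boolp classical_sets functions topology.

Set Implicit Arguments.
Unset Strict Implicit.
Unset Printing Implicit Defensive.

Import Order.Theory.
Local Open Scope classical_set_scope.

(* Points are not required to exist: the frame FI L of a one-element lattice
   has none. *)
Record compatFrame := CompatFrame {
  frame_pt :> Type;
  compat : frame_pt -> frame_pt -> Prop;
  compat_refl : forall x, compat x x }.

Notation "x ◁ y" := (compat x y) (at level 70, no associativity).

Section Closure.
Variable X : compatFrame.
Implicit Types (A B : set X).

Definition compat_cl A : set X :=
  [set x | forall x', x' ◁ x -> exists x'', x' ◁ x'' /\ A x''].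

Lemma sub_compat_cl A : A `<=` compat_cl A.
Proof. by move=> x Ax x' x'x; exists x. Qed.

Lemma compat_cl_mono A B : A `<=` B -> compat_cl A `<=` compat_cl B.
Proof. by move=> AB x Ax x' /Ax[y [x'y /AB By]]; exists y. Qed.

Lemma compat_cl_idem A : compat_cl (compat_cl A) = compat_cl A.
Proof.
apply/seteqP; split; last exact: sub_compat_cl.
by move=> x cx x' /cx[y [x'y /(_ _ x'y)]].
Qed.

Lemma compat_clT : compat_cl setT = setT.
Proof. by apply/seteqP; split=> // x _ x' x'x; exists x. Qed.

Record fixpt := Fixpt {
  fixpt_set :> set X;
  _ : compat_cl fixpt_set == fixpt_set }.

HB.instance Definition _ := [isSub for fixpt_set].
HB.instance Definition _ := [Choice of fixpt by <:].

Fact fixpt_display : Order.disp_t. Proof. exact: Order.Disp tt tt. Qed.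

HB.instance Definition _ :=
  [SubChoice_isSubPOrder of fixpt by <: with fixpt_display].

Implicit Types U V W : fixpt.

Lemma fixptE U : compat_cl U = U.
Proof. by apply/eqP; case: U. Qed.

Lemma le_fixptP U V : reflect (U `<=` V) (U <= V)%O.
Proof. exact: asboolP. Qed.

Lemma fixpt_meet_subproof U V : compat_cl (U `&` V) == U `&` V.
Proof.
apply/eqP/seteqP; split; last exact: sub_compat_cl.
by move=> x cx; split; rewrite -fixptE; apply: compat_cl_mono x cx => x [].
Qed.

Definition fixpt_meet U V : fixpt := Fixpt (fixpt_meet_subproof U V).

Lemma fixpt_join_subproof U V :
  compat_cl (compat_cl (U `|` V)) == compat_cl (U `|` V).
Proof. by rewrite compat_cl_idem. Qed.

Definition fixpt_join U V : fixpt := Fixpt (fixpt_join_subproof U V).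

Lemma fixpt_meetP U V W : (U <= fixpt_meet V W)%O = (U <= V)%O && (U <= W)%O.
Proof.
apply/le_fixptP/andP => [UVW|[/le_fixptP UV /le_fixptP UW] x Ux].
  by split; apply/le_fixptP => x /UVW[].
by split; [exact: UV | exact: UW].
Qed.

Lemma fixpt_joinP U V W : (fixpt_join U V <= W)%O = (U <= W)%O && (V <= W)%O.
Proof.
apply/le_fixptP/andP => [UVW|[/le_fixptP UW /le_fixptP VW]].
  by split; apply/le_fixptP => x Ux; apply: UVW; apply: sub_compat_cl;
    [left | right].
by rewrite -[X in _ `<=` X]fixptE; apply: compat_cl_mono => x [/UW|/VW].
Qed.

HB.instance Definition _ :=
  Order.POrder_isMeetSemilattice.Build fixpt_display fixpt fixpt_meetP.
HB.instance Definition _ :=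
  Order.POrder_isJoinSemilattice.Build fixpt_display fixpt fixpt_joinP.

Definition fixpt_bot : fixpt := Fixpt (introT eqP (compat_cl_idem set0)).
Definition fixpt_top : fixpt := Fixpt (introT eqP compat_clT).

Lemma fixpt_bot_le U : (fixpt_bot <= U)%O.
Proof.
by apply/le_fixptP; rewrite -[X in _ `<=` X]fixptE; exact: compat_cl_mono.
Qed.

Lemma fixpt_le_top U : (U <= fixpt_top)%O.
Proof. exact/le_fixptP. Qed.

HB.instance Definition _ :=
  Order.hasBottom.Build fixpt_display fixpt fixpt_bot_le.
HB.instance Definition _ :=
  Order.hasTop.Build fixpt_display fixpt fixpt_le_top.

End Closure.

Notation "𝔏( X )" := (fixpt X) (at level 0, format "𝔏( X )").

Section FilterIdeal.
Context {d : Order.disp_t}.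

Definition lfilter (L : latticeType d) (F : set L) :=
  [/\ F !=set0,
      forall a b, F a -> (a <= b)%O -> F b &
      forall a b, F a -> F b -> F (Order.meet a b)].

Definition lideal (L : latticeType d) (I : set L) :=
  [/\ I !=set0,
      forall a b, I b -> (a <= b)%O -> I a &
      forall a b, I a -> I b -> I (Order.join a b)].

Variable L : latticeType d.

Record fi_pair := FIPair {
  fi_val : set L * set L;
  _ : `[< [/\ lfilter fi_val.1, lideal fi_val.2 &
              fi_val.1 `&` fi_val.2 = set0] >] }.

HB.instance Definition _ := [isSub for fi_val].
HB.instance Definition _ := [Choice of fi_pair by <:].

Definition fi_filter (x : fi_pair) : set L := (fi_val x).1.
Definition fi_ideal (x : fi_pair) : set L := (fi_val x).2.

Definition fi_compat (x y : fi_pair) := fi_ideal x `&` fi_filter y = set0.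

Lemma fi_compat_refl x : fi_compat x x.
Proof. by case: x => p hp; have /asboolP[_ _] := hp; rewrite /fi_compat setIC. Qed.

Definition FI : compatFrame := CompatFrame fi_compat_refl.

Definition hat (a : L) : set FI := [set x | fi_filter x a].

Definition SL : Type := fi_pair.
HB.instance Definition _ := Choice.on SL.
(* The subbase is indexed by itself. *)
HB.instance Definition _ :=
  @isSubBaseTopological.Build SL (set SL) (range hat) id.

Definition compact_open_fixpts : set 𝔏(FI) :=
  [set U | @open SL U /\ @compact SL U].

End FilterIdeal.

Arguments compact_open_fixpts {d} L.

Section Embeddings.
Context {d d' : Order.disp_t}.

Definition lattice_embedding (L : latticeType d) (M : latticeType d')
    (h : L -> M) :=
  [/\ injective h, Order.meet_morphism h & Order.join_morphism h].

Definition blattice_embedding (L : tbLatticeType d) (M : tbLatticeType d')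
    (h : L -> M) :=
  [/\ lattice_embedding h, h \bot%O = \bot%O & h \top%O = \top%O].

Definition sublattice (M : latticeType d') (S : set M) :=
  forall u v, S u -> S v -> S (Order.meet u v) /\ S (Order.join u v).

Definition bsublattice (M : tbLatticeType d') (S : set M) :=
  [/\ sublattice S, S \bot%O & S \top%O].

(* Meets and joins in a sublattice are those of the ambient lattice. *)
Definition lattice_iso_onto (L : latticeType d) (M : latticeType d')
    (h : L -> M) (S : set M) :=
  [/\ set_bij setT S h, Order.meet_morphism h & Order.join_morphism h].

(* set0 is a compact open fixpoint for every L, by compat_refl, and it is hat a
   only if a is the least element of L. *)
Definition has_least (L : latticeType d) := exists b : L, forall a, (b <= a)%O.

End Embeddings.

(* Main.v *)
Require Import Defs.
From mathcomp Require Import all_boot all_order.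
From mathcomp Require Import finmap.
From mathcomp Require Import boolp classical_sets functions topology.

(** Points of the frame play the role of prime filters, and the only points
    that ever have to be constructed have a principal component: for a filter
    [F] missing [a] the pair [(F, down a)], and for an ideal [I] missing [a]
    the pair [(up a, I)].

    The first kind shows that [hat a] is a fixpoint ([compat_cl_hat]): a point
    [(F, I)] with [a] outside [F] is reached from [(F, down a)], none of whose
    successors contains [a] in its filter.  The second kind shows that
    [hat (a \/ b)] is the join of [hat a] and [hat b] ([hat_join]): an ideal
    missing [a \/ b] misses [a] or [b].  Both together, [(up a, down b)],
    give injectivity.

    On the topological side, [hat (a /\ b)] is the intersection of [hat a] and
    [hat b] and every filter is nonempty, so the sets [hat a] form a base
    ([open_SLP]).  Each nonempty [hat a] is compact for the strongest possible
    reason: it has a point [(up a, I)] whose open neighbourhoods all include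
    [hat a] ([compact_hat]).  Conversely, for a fixpoint [U] the
    set of all [a] with [hat a] included in [U] is closed under joins, since
    [hat (a \/ b)] is the closure of a subset of [U].  So an open fixpoint is a
    directed union of sets [hat a], and if it is compact and nonempty it is one
    of them ([compact_open_fixpt_hat]).

    The empty set is the one compact open fixpoint that escapes this argument.
    It is [hat b] precisely when [b] is the least element of the lattice
    ([hat_eq0P]), which is why lattices with and without a least element are
    distinguished. *)

Set Implicit Arguments.
Unset Strict Implicit.
Unset Printing Implicit Defensive.

Import Order.Theory.

(** * Points with a principal filter or ideal *)

Section Representation.
Context {d : Order.disp_t} (L : latticeType d).
Local Open Scope order_scope.
Local Open Scope classical_set_scope.
Implicit Types (a b : L) (F I : set L) (x : FI L) (U : 𝔏(FI L)).

Definition up a : set L := [set b | a <= b].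
Definition down a : set L := [set b | b <= a].

Lemma lfilter_up a : lfilter (up a).
Proof.
split=> [|b c|b c]; first by exists a; exact: lexx.
  exact: le_trans.
by rewrite /up /= lexI => -> ->.
Qed.

Lemma lideal_down a : lideal (down a).
Proof.
split=> [|b c|b c]; first by exists a; exact: lexx.
  by rewrite /down /= => /[swap]; exact: le_trans.
by rewrite /down /= leUx => -> ->.
Qed.

Lemma fi_filterP x : lfilter (fi_filter x).
Proof. by case: x => p hp; have /asboolP[] := hp. Qed.

Lemma fi_idealP x : lideal (fi_ideal x).
Proof. by case: x => p hp; have /asboolP[] := hp. Qed.

Lemma fi_disjoint x a : fi_filter x a -> fi_ideal x a -> False.
Proof.
case: x => p hp; have /asboolP[_ _ p0] := hp => Fa Ia.
by have : (p.1 `&` p.2) a by []; rewrite p0.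
Qed.

Lemma fi_compatP x y :
  x ◁ y <-> forall a, fi_ideal x a -> fi_filter y a -> False.
Proof.
split=> [xy a Ia Fa|xy]; last by apply/seteqP; split=> // a [/xy].
by have : (fi_ideal x `&` fi_filter y) a by []; rewrite [_ `&` _]xy.
Qed.

Lemma ex_filter_down F a : lfilter F -> ~ F a ->
  exists x, fi_filter x = F /\ fi_ideal x = down a.
Proof.
move=> Ff Fa; have Fup := let: And3 _ up _ := Ff in up.
have h : `[< [/\ lfilter F, lideal (down a) & F `&` down a = set0] >].
  apply/asboolP; split=> //; first exact: lideal_down.
  by apply/seteqP; split=> // b [/Fup Fb ba]; apply/Fa/Fb.
by exists (@FIPair d L (F, down a) h).
Qed.

Lemma ex_up_ideal a I : lideal I -> ~ I a ->
  exists x, fi_filter x = up a /\ fi_ideal x = I.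
Proof.
move=> If Ia; have Idown := let: And3 _ down _ := If in down.
have h : `[< [/\ lfilter (up a), lideal I & up a `&` I = set0] >].
  apply/asboolP; split=> //; first exact: lfilter_up.
  by apply/seteqP; split=> // b [ab /Idown Ib]; apply/Ia/Ib.
by exists (@FIPair d L (up a, I) h).
Qed.

(** * The embedding into the fixpoints *)

Lemma hat_mono a b : a <= b -> hat a `<=` hat b.
Proof. by move=> ab x; have [_ Fup _] := fi_filterP x => /Fup; exact. Qed.

Lemma subset_hat a b : hat a `<=` hat b -> a <= b.
Proof.
move=> sab; apply: contrapT => ab.
have [x [xF xI]] := ex_filter_down (lfilter_up a) ab.
have ax : hat a x by rewrite /hat /= xF; exact: lexx.
by apply: (@fi_disjoint x b); [exact: sab | rewrite xI; exact: lexx].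
Qed.

Lemma hat_meet a b : hat (a `&` b)%O = hat a `&` hat b.
Proof.
apply/seteqP; split=> [x abx|x [ax bx]].
  by split; apply: hat_mono abx; [exact: leIl | exact: leIr].
by have [_ _ FI] := fi_filterP x; exact: FI.
Qed.

(** If the filter of [x] misses [a], then [(F, down a)], with [F] that filter,
    is below [x] and has no successor in [hat a]. *)
Lemma compat_cl_hat a : compat_cl (hat a) = hat a.
Proof.
apply/seteqP; split; last exact: sub_compat_cl.
move=> x cx; apply: contrapT => Fa.
have [y [yF yI]] := ex_filter_down (fi_filterP x) Fa.
have yx : y ◁ x.
  apply/fi_compatP => b; rewrite yI => ba Fb.
  by apply: Fa; apply: hat_mono ba x Fb.
have [z [/fi_compatP yz za]] := cx _ yx.
by apply: (yz a) => //; rewrite yI; exact: lexx.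
Qed.

(** An ideal missing [a \/ b] misses [a] or [b], say [a]; keeping that ideal
    and passing to the filter [up a] leads into [hat a]. *)
Lemma hat_join a b : hat (a `|` b)%O = compat_cl (hat a `|` hat b).
Proof.
apply/seteqP; split; last first.
  rewrite -[X in _ `<=` X]compat_cl_hat; apply: compat_cl_mono.
  by move=> x []; apply: hat_mono; [exact: leUl | exact: leUr].
move=> x abx y /fi_compatP yx.
have into_hat c : ~ fi_ideal y c -> exists z, y ◁ z /\ hat c z.
  move=> Ic; have [z [zF zI]] := ex_up_ideal (fi_idealP y) Ic.
  exists z; split; last by rewrite /hat /= zF; exact: lexx.
  by apply/fi_compatP => e Ie Fe; apply: (@fi_disjoint z e); rewrite ?zI.
have [Ia|/into_hat[z [yz za]]] := pselect (fi_ideal y a); last first.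
  by exists z; split=> //; left.
have [Ib|/into_hat[z [yz zb]]] := pselect (fi_ideal y b); last first.
  by exists z; split=> //; right.
have [_ _ IU] := fi_idealP y.
by case: (yx _ (IU _ _ Ia Ib) abx).
Qed.

Definition hat_fixpt a : 𝔏(FI L) := Fixpt (introT eqP (compat_cl_hat a)).

Lemma lattice_embedding_hat : lattice_embedding hat_fixpt.
Proof.
split=> [a b /(congr1 (@fixpt_set _)) /= eab|a b|a b].
- by apply/le_anti/andP; split; apply: subset_hat; rewrite eab.
- by apply: val_inj; exact: hat_meet.
- by apply: val_inj; exact: hat_join.
Qed.

Lemma hat_eq0P a : hat a = set0 <-> forall b, a <= b.
Proof.
split=> [a0 b|le_a]; first by apply: subset_hat; rewrite a0.
apply/seteqP; split=> // x ax; have [[b Ib] Idown _] := fi_idealP x.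
by apply: fi_disjoint ax (Idown _ _ Ib (le_a b)).
Qed.

(** * Compact open fixpoints *)

Lemma open_hat a : @open (SL L) (hat a).
Proof.
exists [set hat a]; last by rewrite bigcup_set1.
by move=> _ ->; apply: (@finI_from1 _ _ _ id); exists a.
Qed.

(** Filters being nonempty is what makes the empty intersection of subbasic
    sets, the whole space, a union of sets [hat a]. *)
Lemma open_SLP (U : set (SL L)) :
  open U <-> forall x, U x -> exists2 a, hat a x & hat a `<=` U.
Proof.
split; last first.
  move=> Ubase; rewrite openE => x /Ubase[a ax aU].
  by rewrite /interior nbhsE; exists (hat a) => //; split=> //; exact: open_hat.
case=> D' sD' <- x [B D'B Bx].
suff [a ax aB] : exists2 a, hat a x & hat a `<=` B.
  by exists a => // y /aB By; exists B.
have [E sE EB] := sD' _ D'B.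
pose s : seq (set (SL L)) := enum_fset E.
have ss A : A \in s -> range (@hat d L) A by move=> /sE /set_mem.
have {Bx} sx A : A \in s -> A x by move=> As; move: Bx; rewrite -EB; exact.
suff [a ax sub_a] : exists2 a, hat a x & forall A, A \in s -> hat a `<=` A.
  by exists a => // y ay; rewrite -EB => A /sub_a; exact.
elim: s ss sx => [_ _|A s IHs ss sx].
  by have [[a Fa] _ _] := fi_filterP x; exists a.
have [A' A's|A' A's|a ax sub_a] := IHs.
- by apply: ss; rewrite inE A's orbT.
- by apply: sx; rewrite inE A's orbT.
have [b _ bA] := ss A (mem_head _ _).
have bx : hat b x by rewrite bA; apply: sx; exact: mem_head.
exists (a `&` b)%O; first by rewrite hat_meet.
rewrite hat_meet => A'; rewrite inE => /orP[/eqP->|/sub_a aA'].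
  by rewrite -bA; exact: subIsetr.
by apply: subset_trans aA'; exact: subIsetl.
Qed.

(** Any point of [hat a] supplies an ideal [I] missing [a].  Every open set
    around [(up a, I)] contains [hat a], so any proper filter that contains
    [hat a] clusters at that point. *)
Lemma compact_hat a : @compact (SL L) (hat a).
Proof.
move=> G Gproper Ga; have [y ay] := @filter_ex _ _ Gproper _ Ga.
have Ia : ~ fi_ideal y a by exact: fi_disjoint ay.
have [x [xF xI]] := ex_up_ideal (fi_idealP y) Ia.
exists x; split; first by rewrite /hat /= xF; exact: lexx.
move=> A B GA; rewrite nbhsE => -[C [/open_SLP Cop Cx] CB].
have [b bx bC] := Cop _ Cx.
have ab : a <= b by move: bx; rewrite /hat /= xF.
have [z [Az az]] := @filter_ex _ _ Gproper _ (@filterI _ _ _ _ _ GA Ga).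
by exists z; split=> //; apply/CB/bC; exact: hat_mono az.
Qed.

Lemma compact_open_hat a : compact_open_fixpts L (hat_fixpt a).
Proof. by split; [exact: open_hat | exact: compact_hat]. Qed.

(** The sets [hat a] inside a fixpoint are directed under inclusion.  If no
    single one of them exhausted [U], the sets [U \ hat a] would generate a
    proper filter, and a cluster point of it in [U] would lie in some [hat a],
    a neighbourhood of it that misses [U \ hat a]. *)
Lemma compact_open_fixpt_hat U :
  compact_open_fixpts L U -> fixpt_set U !=set0 -> exists a, U = hat_fixpt a.
Proof.
move=> [/open_SLP Uop Uco] [x0 Ux0].
pose D : set L := [set a | hat a `<=` U].
have DU a b : D a -> D b -> D (a `|` b)%O.
  move=> aU bU; rewrite /D /= hat_join -[fixpt_set U]fixptE.
  by apply: (@compat_cl_mono (FI L)) => x [/aU|/bU].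
apply: contrapT => noU.
pose G : set_system (SL L) := filter_from D (fun a => fixpt_set U `\` hat a).
have [a0 _ Da0] := Uop _ Ux0.
have Gproper : ProperFilter G.
  apply: filter_from_proper => [|a aU].
    apply: filter_from_filter; first by exists a0.
    move=> a b Da Db; exists (a `|` b)%O; first exact: DU.
    by move=> x [Ux abx]; split; split=> // cx; apply: abx;
      apply: hat_mono cx; [exact: leUl | exact: leUr].
  apply/set0P/eqP; rewrite setD_eq0 => Ua.
  by apply: noU; exists a; apply: val_inj; apply/seteqP.
have GU : G (fixpt_set U) by exists a0 => //; exact: subDsetl.
have [x [Ux xG]] := Uco _ Gproper GU.
have [a ax aU] := Uop _ Ux.
have Ga : G (fixpt_set U `\` hat a) by exists a.
have xa : nbhs (x : SL L) (hat a).
  by apply: open_nbhs_nbhs; split=> //; exact: open_hat.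
by have [y [[_ nya] ya]] := xG _ _ Ga xa.
Qed.

Lemma has_least_compact_open :
  has_least L -> compact_open_fixpts L = range hat_fixpt.
Proof.
move=> [b /hat_eq0P b0]; apply/seteqP; split=> [U Uco|_ [a _ <-]].
  have [U0|/eqP/set0P/(compact_open_fixpt_hat Uco)[a ->]] :=
    pselect (fixpt_set U = set0); last by exists a.
  by exists b => //; apply: val_inj; rewrite /= b0.
exact: compact_open_hat.
Qed.

Lemma no_least_compact_open : ~ has_least L ->
  [set U | compact_open_fixpts L U /\ fixpt_set U <> set0] = range hat_fixpt.
Proof.
move=> noleast; apply/seteqP; split=> [U [Uco]|_ [a _ <-]].
  by move=> /eqP/set0P/(compact_open_fixpt_hat Uco)[a ->]; exists a.
split; first exact: compact_open_hat.
by move=> /hat_eq0P le_a; apply: noleast; exists a.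
Qed.

End Representation.

(** * Images of embeddings *)

Section Image.
Context {d d' : Order.disp_t} (L : latticeType d) (M : latticeType d').
Variable h : L -> M.
Hypothesis h_emb : lattice_embedding h.

Lemma sublattice_range : sublattice (range h).
Proof.
have [_ hI hU] := h_emb.
by move=> _ _ [a _ <-] [b _ <-]; rewrite -hI -hU.
Qed.

Lemma lattice_iso_onto_range : lattice_iso_onto h (range h).
Proof.
have [h_inj hI hU] := h_emb; split=> //; split=> //.
by move=> a b _ _; exact: h_inj.
Qed.

End Image.

Theorem theorem3p20 :
  (forall (d : Order.disp_t) (L : latticeType d),
    exists h : L -> 𝔏(FI L),
      [/\ (forall a : L, fixpt_set (h a) = hat a),
          lattice_embedding h,
          (has_least L ->
             sublattice (compact_open_fixpts L) /\
             lattice_iso_onto h (compact_open_fixpts L)) &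
          (~ has_least L ->
             let S := [set U | compact_open_fixpts L U /\ fixpt_set U <> set0]%classic in
             sublattice S /\ lattice_iso_onto h S)])
  /\
  (forall (d : Order.disp_t) (L : tbLatticeType d),
    exists h : L -> 𝔏(FI L),
      [/\ (forall a : L, fixpt_set (h a) = hat a),
          blattice_embedding h,
          bsublattice (compact_open_fixpts L) &
          lattice_iso_onto h (compact_open_fixpts L)]).
Proof.
split=> d L; exists (@hat_fixpt d L); have emb := lattice_embedding_hat L.
  split=> // [least|noleast].
    rewrite has_least_compact_open //; split; first exact: sublattice_range.
    exact: lattice_iso_onto_range.
  rewrite no_least_compact_open //; split; first exact: sublattice_range.
  exact: lattice_iso_onto_range.
have h0 : hat_fixpt (\bot%O : L) = \bot%O.
  apply/le_anti; rewrite le0x andbT; apply/le_fixptP.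
  by rewrite /= (hat_eq0P _).2.
have h1 : hat_fixpt (\top%O : L) = \top%O.
  apply/le_anti; rewrite lex1; apply/le_fixptP => x _.
  have [[a Fa] Fup _] := fi_filterP x.
  exact: Fup Fa (lex1 a).
have least : has_least L by exists \bot%O.
split=> //; rewrite has_least_compact_open //; last exact: lattice_iso_onto_range.
by split; [exact: sublattice_range | rewrite -h0 | rewrite -h1].
Qed.
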